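(* Let $\theta \in (0,1)\cup (1,3/2)$. There exists an effective constant $C_{\theta}>0$, depending only on $\theta$, such that for every $\alpha \in \mathbb{R}$ and every $n\in\mathbb{N}$, $$\min_{1 \leq u,v \leq n}\|u^{\theta} + v^{\theta} - \alpha\| \leq C_{\theta}\cdot n^{\theta - 3/2},$$ where the minimum is over integers $u,v$.
   Context: $\mathbb{N}=\{1,2,\ldots\}$. For real $x$, $\|x\| := \min_{m\in\mathbb{Z}}|x-m|$ denotes the distance to the nearest integer. ''Effective'' means that the constant can in principle be computed explicitly. *)

(* Defs.v *)
From HB Require Import structures.
From mathcomp Require Import all_boot all_order all_algebra.
From mathcomp Require Import all_classical all_reals all_analysis.
From mathcomp Require Import lra.
Set Implicit Arguments.
Unset Strict Implicit.
Unset Printing Implicit Defensive.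
Import Order.TTheory GRing.Theory Num.Theory.
Import numFieldNormedType.Exports.
Local Open Scope classical_set_scope.
Local Open Scope ring_scope.

(* Both minima are written as infima; [dist_int_attained] and
   [min_dist_attained] show that they are attained. *)
Definition dist_int {R : realType} (x : R) : R :=
  inf [set `|x - m%:~R| | m in [set: int]].

Definition min_dist {R : realType} (theta alpha : R) (n : nat) : R :=
  inf [set dist_int (p.1%:R `^ theta + p.2%:R `^ theta - alpha)
      | p in [set p : nat * nat | (1 <= p.1 <= n)%N /\ (1 <= p.2 <= n)%N]].

(* Partial recursive functions relative to an oracle phi : nat -> nat.
   Arities are not tracked: missing arguments are read as 0 and extra ones are
   ignored. *)
Inductive recfun : Type :=
| RZero
| RSucc
| RProj of nat
| ROracle
| RComp of recfun & seq recfun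
| RPrec of recfun & recfun
| RMu of recfun.

(* [eval phi f xs y]: the computation of f on the arguments xs, with oracle phi,
   halts with value y. *)
Inductive eval (phi : nat -> nat) : recfun -> seq nat -> nat -> Prop :=
| EvalZero xs : eval phi RZero xs 0%N
| EvalSucc xs : eval phi RSucc xs (nth 0%N xs 0).+1
| EvalProj i xs : eval phi (RProj i) xs (nth 0%N xs i)
| EvalOracle xs : eval phi ROracle xs (phi (nth 0%N xs 0))
| EvalComp f gs xs ys z :
    evals phi gs xs ys -> eval phi f ys z -> eval phi (RComp f gs) xs z
| EvalPrec0 f g xs z :
    eval phi f xs z -> eval phi (RPrec f g) (0%N :: xs) z
| EvalPrecS f g k xs y z :
    eval phi (RPrec f g) (k :: xs) y -> eval phi g [:: k, y & xs] z ->
    eval phi (RPrec f g) (k.+1 :: xs) z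
| EvalMu f xs k :
    eval phi f (k :: xs) 0%N ->
    (forall j, (j < k)%N -> exists y, eval phi f (j :: xs) y.+1) ->
    eval phi (RMu f) xs k
with evals (phi : nat -> nat) : seq recfun -> seq nat -> seq nat -> Prop :=
| EvalsNil xs : evals phi [::] xs [::]
| EvalsCons g gs xs y ys :
    eval phi g xs y -> evals phi gs xs ys ->
    evals phi (g :: gs) xs (y :: ys).

(* phi gives dyadic approximations |x - phi k / 2^k| <= 2^-k of x >= 0. *)
Definition is_name {R : realType} (phi : nat -> nat) (x : R) : Prop :=
  forall k, `|x - (phi k)%:R / 2 ^+ k| <= 2 ^- k.

(* Computability of a nonnegative function on a set of nonnegative reals, in the
   sense of computable analysis: one algorithm turns every name of x into a name
   of F x. *)
Definition computable_on {R : realType} (D : set R) (F : R -> R) : Prop :=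
  exists e : recfun, forall x, D x -> forall phi, is_name phi x ->
    exists2 psi, is_name psi (F x) & forall k, eval phi e [:: k] (psi k).

Lemma dist_int_attained (R : realType) (x : R) :
  exists m : int, dist_int x = `|x - m%:~R|.
Proof.
have near m : `|x - (Num.floor (x + 2^-1))%:~R| <= `|x - m%:~R|.
  have /andP[h1 h2] := floor_itv (x + 2^-1).
  set f := Num.floor _ in h1 h2 *.
  have [->//|/eqP nm] := eqVneq m f.
  have h : `|x - f%:~R| <= 2^-1.
    by move: h2; rewrite intrD => h2; rewrite ler_norml; apply/andP; split; lra.
  have h1' : 1 <= `|f%:~R - m%:~R : R|.
    rewrite -intrB -intr_norm -[1]/(1%:~R) ler_int -gtz0_ge1 normr_gt0 subr_eq0.
    by apply/eqP => e; apply: nm.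
  have h3 : `|f%:~R - m%:~R : R| <= `|x - f%:~R| + `|x - m%:~R|.
    have -> : f%:~R - m%:~R = (f%:~R - x) + (x - m%:~R) :> R by rewrite addrA subrK.
    by rewrite (le_trans (ler_normD _ _)) // distrC.
  apply: (le_trans h); rewrite -(lerD2l 2^-1).
  have -> : 2^-1 + 2^-1 = 1 :> R by lra.
  apply: (le_trans h1'); apply: (le_trans h3); exact: lerD.
exists (Num.floor (x + 2^-1)); apply/eqP; rewrite eq_le; apply/andP; split.
  apply: ge_inf; last by exists (Num.floor (x + 2^-1)).
  by exists 0 => _ [m _ <-].
apply: lb_le_inf; first by exists `|x - 0%:~R|, 0.
by move=> _ [m _ <-].
Qed.

Lemma min_dist_attained (R : realType) (theta alpha : R) (n : nat) :
  (0 < n)%N -> exists u v : nat, [/\ (1 <= u <= n)%N, (1 <= v <= n)%N &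
    min_dist theta alpha n = dist_int (u%:R `^ theta + v%:R `^ theta - alpha)].
Proof.
case: n => // n _.
pose F (p : nat * nat) := dist_int (p.1%:R `^ theta + p.2%:R `^ theta - alpha).
pose G (p : 'I_n.+1 * 'I_n.+1) := F (p.1.+1, p.2.+1).
have [[u v] _ umin] := @Order.TotalTheory.arg_minP _ _ _ (ord0, ord0) predT G isT.
exists u.+1, v.+1; split; rewrite ?ltn_ord//.
have lb : lbound [set F p | p in
    [set p : nat * nat | (1 <= p.1 <= n.+1)%N /\ (1 <= p.2 <= n.+1)%N]] (G (u, v)).
  move=> _ [[[|a] [|b]]] /= [] // an bn <-.
  exact: (umin (Ordinal an, Ordinal bn) isT).
have inS : [set F p | p in
    [set p : nat * nat | (1 <= p.1 <= n.+1)%N /\ (1 <= p.2 <= n.+1)%N]] (G (u, v)).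
  by exists (u.+1, v.+1) => //=; split; apply: ltn_ord.
apply/eqP; rewrite eq_le; apply/andP; split.
  by apply: ge_inf => //; exists (G (u, v)).
by apply: lb_le_inf => //; exists (G (u, v)).
Qed.

(* Main.v *)
Require Import Defs.
From mathcomp Require Import all_boot all_order all_algebra.
From mathcomp Require Import all_classical all_reals all_analysis.
From mathcomp Require Import zify ring lra.
Set Implicit Arguments.
Unset Strict Implicit.
Import Order.TTheory GRing.Theory Num.Theory.
Import numFieldNormedType.Exports.
Local Open Scope classical_set_scope.
Local Open Scope ring_scope.

(** Already the pairs (N + i, N - i) suffice.  Put
    s_N(i) = (N + i)^theta + (N - i)^theta.  A second order expansion gives
    s_N(i) = 2 N^theta + theta (theta - 1) N^(theta - 2) i^2 (1 + o(1)).  For i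
    of size at most K sqrt N, consecutive values of s_N therefore differ by
    O(K N^(theta - 3/2)), the accuracy wanted, while s_N as a whole moves away
    from 2 N^theta by about theta |theta - 1| K^2 N^(theta - 1).  For K^2 a large
    multiple of 1 / |theta - 1| this exceeds the distance
    2 (N + 1)^theta - 2 N^theta, of size 2 theta N^(theta - 1), between the
    starting points of neighbouring walks.  The walks s_N move upwards for
    theta > 1 and downwards for theta < 1, so in both cases the walks with
    M <= N <= 4 M leave no gap of length more than O(K M^(theta - 3/2)) between
    2 M^theta and 2 (4 M)^theta ([symsum_dense]).  Once theta M^theta >= 1 this
    interval has length at least 1, hence meets alpha + Z; taking M of the order
    of n proves the bound ([min_dist_large]).  For smaller n the bound is
    obtained by making the constant large ([min_dist_small]).

    If j >= 1 / min(theta, |theta - 1|), the constant 2^(40 j^2) works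
    ([min_dist_bound]).  It depends on theta discontinuously through j, whereas a
    computable function of a real is continuous.  With d = min(theta,
    |theta - 1|), the constant used is therefore
    C(theta) = sum over j of 2^(40 j^2) max(0, 3 - j d): only the j < 3 / d
    contribute, and some j with 1 <= j d <= 2 does so with a factor at least 1.
    A program computes C from a name of theta by first searching for an integer
    L >= 3 / d, which bounds the summation range and the precision needed, then
    evaluating the sum in integers at that precision and rounding
    ([eff_const_computable]). *)

(** * Mean value estimates for real powers *)

Lemma powR_MVT (R : realType) (a x y : R) : 0 < x -> x < y ->
  exists2 c, x < c < y & y `^ a - x `^ a = a * c `^ (a - 1) * (y - x).
Proof.
move=> x0 xy.
have [||c] := MVT (f := @powR R ^~ a) (df := fun z => a * z `^ (a - 1)) xy.
- by move=> z; rewrite in_itv/= => /andP[xz _]; apply: is_derive1_powR; lra.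
- apply: derivable_within_continuous => z; rewrite in_itv/= => /andP[xz _].
  by apply: derivable_powR; rewrite in_itv/= andbT; lra.
- by rewrite in_itv/= => cxy E; exists c.
Qed.

Lemma powR_le_nat (R : realType) (B a : R) (p : nat) :
  1 <= B -> a <= p%:R -> B `^ a <= B ^+ p.
Proof. by move=> B1 ap; rewrite -powR_mulrn ?ler_powR//; lra. Qed.

(** Passing to inverses exchanges x and y and reverses the sign of the exponent,
    so only nonnegative exponents need an argument.  This is how all powers at
    intermediate points are compared with powers of one scale M. *)
Lemma powR_comparable (R : realType) (B a x y : R) (p : nat) :
  0 < x -> 0 < y -> x <= B * y -> y <= B * x -> `|a| <= p%:R ->
  x `^ a <= B ^+ p * y `^ a.
Proof.
move=> x0 y0 xy yx; rewrite ler_norml => /andP[a1 a2].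
have B1 : 1 <= B by nra.
have nonneg b u v : 0 < u -> 0 < v -> u <= B * v -> 0 <= b -> b <= p%:R ->
    u `^ b <= B ^+ p * v `^ b.
  move=> u0 v0 uv b0 bp.
  apply: (@le_trans _ _ ((B * v) `^ b)).
    by apply: ge0_ler_powR => //; rewrite nnegrE; nra.
  rewrite powRM; [|lra|lra].
  by apply: ler_wpM2r; [exact: powR_ge0|exact: powR_le_nat].
have [a0|a0] := leP 0 a; first exact: nonneg.
have := nonneg (- a) y x y0 x0 yx; rewrite !powRN.
have X0 : 0 < x `^ a by exact: powR_gt0.
have Y0 : 0 < y `^ a by exact: powR_gt0.
move=> /(_ ltac:(lra) ltac:(lra)).
by rewrite ler_pdivlMr// ler_pdivrMl// mulrC.
Qed.

(** The mean value theorem on both unit intervals gives a (u^(a-1) - v^(a-1))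
    with u in (y, y+1) and v in (x, x+1), and a third application between v and u
    gives the factor e = u - v. *)
Lemma powR_second_difference (R : realType) (a x y : R) : 0 < x -> x + 1 <= y ->
  exists c e : R, [/\ x < c < y + 1, y - x - 1 <= e <= y - x + 1 &
    ((y + 1) `^ a - y `^ a) - ((x + 1) `^ a - x `^ a) =
      a * (a - 1) * c `^ (a - 2) * e].
Proof.
move=> x0 xy.
have [|//|u /andP[u1 u2] ->] := @powR_MVT R a y (y + 1); [lra|lra|].
have [//|//|v /andP[v1 v2] ->] := @powR_MVT R a x (x + 1); [lra|].
have [||c /andP[c1 c2] E] := @powR_MVT R (a - 1) v u; [lra|lra|].
exists c, (u - v); split; [lra|lra|].
have -> : a - 2 = a - 1 - 1 by lra.
have -> : y + 1 - y = 1 by ring.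
have -> : x + 1 - x = 1 by ring.
by rewrite !mulr1 -mulrBr E; ring.
Qed.

(** * Density of the symmetric sums *)

Lemma discrete_ivt (R : realType) (a : nat -> R) (e y : R) (n : nat) :
  0 <= e -> (forall i, (i < n)%N -> `|a i.+1 - a i| <= e) ->
  a 0%N <= y <= a n \/ a n <= y <= a 0%N ->
  exists2 i, (i <= n)%N & `|a i - y| <= e.
Proof.
move=> e0; elim: n => [|n IH] step h.
  by exists 0%N => //; rewrite ler_norml; lra.
have [h'|h'] : (a 0%N <= y <= a n \/ a n <= y <= a 0%N) \/
    (a n <= y <= a n.+1 \/ a n.+1 <= y <= a n).
  by have [|] := leP y (a n); case: h => /andP[? ?] ?; lra.
- have [j jn|i i1 i2] := IH _ h'; first by apply: step; apply: leqW.
  by exists i => //; exact: leqW.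
- exists n => //; have := step n (ltnSn n).
  by rewrite !ler_norml; case: h' => /andP[? ?] /andP[? ?]; lra.
Qed.

(** One walk: N is fixed and i = 0, 1, 2, ... moves the two arguments apart. *)
Definition symsum (R : realType) (theta : R) (N i : nat) : R :=
  (N + i)%:R `^ theta + (N - i)%:R `^ theta.

(** The increment is a second difference of the power function with arguments
    about 2 i apart, all within [M / 2, 8 M].  The lower bound on e is
    nonnegative, so no step of a walk goes against the sign of theta - 1. *)
Lemma symsum_step (R : realType) (theta M : R) (N i : nat) :
  0 < theta < 3 / 2 -> 0 < M -> (i.+1 <= N)%N ->
  M <= 2 * (N%:R - i.+1%:R) -> N%:R + i.+1%:R <= 8 * M ->
  exists e : R, theta * M `^ (theta - 2) / 64 * (2 * i%:R) <= e <=
      theta * M `^ (theta - 2) * 64 * (2 * i.+1%:R) /\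
    symsum theta N i.+1 - symsum theta N i = (theta - 1) * e.
Proof.
move=> /andP[t0 t1] M0 iN lo hi.
have i0 : 0 <= i%:R :> R by exact: ler0n.
rewrite -[i.+1%:R]natr1 in lo hi *.
have E : (N - i)%:R = (N - i.+1)%:R + 1 :> R by rewrite natr1; congr (_%:R); lia.
have F : (N - i.+1)%:R = N%:R - (i%:R + 1) :> R by rewrite natrB// natr1.
have [||c [e [/andP[c1 c2] /andP[e1 e2] H]]] :=
  @powR_second_difference R theta (N - i.+1)%:R (N + i)%:R.
- by rewrite F; lra.
- by rewrite F natrD; lra.
rewrite F natrD in c1 c2 e1 e2.
have c0 : 0 < c by lra.
have [k1 k2] : c `^ (theta - 2) <= 64 * M `^ (theta - 2) /\
    M `^ (theta - 2) <= 64 * c `^ (theta - 2).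
  have -> : 64 = 8 ^+ 2 :> R by ring.
  by split; apply: powR_comparable; rewrite ?ler_norml//; lra.
have P0 : 0 < M `^ (theta - 2) by exact: powR_gt0.
have C0 : 0 < c `^ (theta - 2) by exact: powR_gt0.
exists (theta * c `^ (theta - 2) * e); split.
  apply/andP; split.
    rewrite -!mulrA ler_pM2l// mulrA; apply: ler_pM => //; lra.
  by rewrite -!mulrA ler_pM2l// mulrA; apply: ler_pM => //; lra.
rewrite /symsum addnS E -natr1; move: H => /[!natrD] H.
by lra.
Qed.

Lemma symsum_range (R : realType) (theta M : R) (N I : nat) :
  0 < theta < 3 / 2 -> 0 < M -> (I <= N)%N ->
  M <= 2 * (N%:R - I%:R) -> N%:R + I%:R <= 8 * M ->
  exists2 e : R, theta * M `^ (theta - 2) / 64 * (I%:R * (I%:R - 1)) <= e &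
    symsum theta N I - symsum theta N 0 = (theta - 1) * e.
Proof.
move=> t M0; elim: I => [|I IH] IN lo hi.
  by exists 0; rewrite ?mul0r ?mulr0 // subrr.
have [e [/andP[e1 _] E]] := symsum_step t M0 IN lo hi.
rewrite -[I.+1%:R]natr1 in lo hi *.
have [||f f1 F] := IH (ltnW IN); [lra|lra|].
exists (e + f); last by rewrite mulrDr -E -F; ring.
rewrite addrK; apply: le_trans (lerD e1 f1); rewrite -mulrDr.
  suff -> : 2 * I%:R + I%:R * (I%:R - 1) = (I%:R + 1) * I%:R :> R by [].
  by ring.
Qed.

Lemma powR_gap (R : realType) (theta M x : R) :
  0 < theta < 3 / 2 -> 0 < M -> M <= x -> x + 1 <= 8 * M ->
  (x + 1) `^ theta - x `^ theta <= 8 * theta * M `^ (theta - 1).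
Proof.
move=> /andP[t0 t1] M0 Mx xM.
have [||c /andP[c1 c2] ->] := @powR_MVT R theta x (x + 1); [lra|lra|].
have : c `^ (theta - 1) <= 8 ^+ 1 * M `^ (theta - 1).
  by apply: powR_comparable; rewrite ?ler_norml//; lra.
rewrite expr1; have -> : x + 1 - x = 1 by ring.
by rewrite mulr1 -(ler_pM2l t0) => h; lra.
Qed.

(** Under this size condition the walks cover an interval of length 1, which is
    what is needed to meet every class modulo 1. *)
Lemma powR_growth (R : realType) (theta M : R) :
  0 < theta < 3 / 2 -> 0 < M -> 1 <= theta * M `^ theta ->
  2 * M `^ theta + 1 <= 2 * (4 * M) `^ theta.
Proof.
move=> /andP[t0 t1] M0 big.
have [||c /andP[c1 c2] E] := @powR_MVT R theta M (4 * M); [lra|lra|].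
have : M `^ (theta - 1) <= 4 ^+ 1 * c `^ (theta - 1).
  by apply: powR_comparable; rewrite ?ler_norml//; lra.
rewrite expr1 => h.
have K : M * M `^ (theta - 1) = M `^ theta by apply: mulr_powRB1; lra.
have tM : 0 < theta * M by exact: mulr_gt0.
rewrite -(ler_pM2l tM) in h.
by rewrite -K in big; lra.
Qed.

Lemma bracket (R : realType) (a : nat -> R) (y : R) (M k : nat) :
  (0 < k)%N -> a M <= y <= a (M + k)%N ->
  exists2 N, (M <= N < M + k)%N & a N <= y <= a N.+1.
Proof.
case: k => // k _; elim: k => [|k IH] /andP[h1 h2].
  by exists M; rewrite ?leqnn ?addn1//= h1 -addn1.
have [h|h] := leP y (a (M + k.+1)%N).
  have [|N /andP[N1 N2] N3] := IH; first by rewrite h1.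
  by exists N; rewrite // N1 (leq_trans N2)// leq_add2l.
exists (M + k.+1)%N; first by lia.
by rewrite (ltW h) -addnS.
Qed.

(** A target y lies between 2 N^theta and 2 (N + 1)^theta for some N.  For
    theta > 1 the walk that starts at the lower end climbs past the upper end
    within I = 64 j m = O(sqrt M) steps; for theta < 1 the walk from the upper end
    descends past the lower end.  The factor 64 j in I makes
    theta |theta - 1| I^2 M^(theta - 2) outweigh the distance, of order
    theta M^(theta - 1), between starting points, including all comparison constants, and
    m >= 128 j keeps I below M / 2, hence all arguments comparable with M. *)
Lemma symsum_dense (R : realType) (theta y : R) (j m : nat) :
  0 < theta < 3 / 2 -> 1 <= j%:R * `|theta - 1| -> (128 * j <= m)%N ->
  forall M : R, M = m%:R ^+ 2 ->
  2 * M `^ theta <= y <= 2 * (4 * M) `^ theta ->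
  exists N i, [/\ (i < N)%N, (N + i <= 8 * m ^ 2)%N &
    `|symsum theta N i - y| <= 96 * (64 * j * m)%:R * M `^ (theta - 2)].
Proof.
move=> t jt jm M MD yM.
have j0 : (0 < j)%N by case: j jt {jm} => // ; rewrite mul0r ler10.
have [I ID] : exists I, I = (64 * j * m)%N by exists (64 * j * m)%N.
rewrite -ID.
have m0 : (0 < m)%N by lia.
have mR : 1 <= m%:R :> R by rewrite ler1n.
have M0 : 0 < M by rewrite MD; nra.
have I2 : (2 * I <= m ^ 2)%N by rewrite ID; nia.
have ME : M = (m ^ 2)%:R by rewrite MD natrX.
have IR : 2 * I%:R <= M by rewrite ME -natrM ler_nat.
have P2 : 0 < M `^ (theta - 2) by exact: powR_gt0.
(* a step has size at most |theta - 1| theta * 64 M^(theta-2) * 2 I, and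
   |theta - 1| theta <= 3/4 *)
have walk N y' : (m ^ 2 <= N <= 4 * m ^ 2)%N ->
    symsum theta N 0 <= y' <= symsum theta N I \/
    symsum theta N I <= y' <= symsum theta N 0 ->
    exists2 i, (i <= I)%N &
      `|symsum theta N i - y'| <= 96 * I%:R * M `^ (theta - 2).
  move=> /andP[N1 N2]; apply: (@discrete_ivt R (symsum theta N)).
    by rewrite !mulr_ge0// ltW.
  have N1R : M <= N%:R by rewrite ME ler_nat.
  have N2R : N%:R <= 4 * M by rewrite ME -natrM ler_nat.
  move=> i iI.
  have iN : (i.+1 <= N)%N by clear -iI I2 N1; lia.
  have iR : i.+1%:R <= I%:R :> R by rewrite ler_nat.
  have [||e [/andP[e1 e2] ->]] := @symsum_step R theta M N i t M0 iN.
  - by clear -iR IR N1R; lra.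
  - by clear -iR IR N1R N2R; lra.
  rewrite normrM.
  have e0 : 0 <= e by apply: le_trans e1; rewrite !mulr_ge0 ?invr_ge0//; lra.
  rewrite (ger0_norm e0).
  have h : `|theta - 1| * theta <= 3 / 4.
    by have [h|h] := leP 0 (theta - 1); [rewrite ger0_norm|rewrite ltr0_norm]; nra.
  have -> : 96 * I%:R = 3 / 4 * 64 * (2 * I%:R) :> R by field.
  apply: (@le_trans _ _ (`|theta - 1| * (theta * M `^ (theta - 2) * 64 * (2 * I%:R)))).
    apply: ler_wpM2l => //; apply: (le_trans e2); apply: ler_wpM2l; last by lra.
    by rewrite !mulr_ge0//; lra.
  have -> : `|theta - 1| * (theta * M `^ (theta - 2) * 64 * (2 * I%:R)) =
    (`|theta - 1| * theta) * (M `^ (theta - 2) * 64 * (2 * I%:R)) by ring.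
  have -> : 3 / 4 * 64 * (2 * I%:R) * M `^ (theta - 2) =
    3 / 4 * (M `^ (theta - 2) * 64 * (2 * I%:R)) by ring.
  by apply: ler_wpM2r => //; rewrite !mulr_ge0// ltW.
(* after I steps a walk has moved by at least the distance to the start of the
   next one *)
have reach N : (m ^ 2 <= N <= 4 * m ^ 2)%N ->
    exists2 e, 16 * theta * M `^ (theta - 1) <= `|theta - 1| * e &
      symsum theta N I - symsum theta N 0 = (theta - 1) * e.
  move=> /andP[N1 N2].
  have N1R : M <= N%:R by rewrite ME ler_nat.
  have N2R : N%:R <= 4 * M by rewrite ME -natrM ler_nat.
  have IN : (I <= N)%N by clear -I2 N1; lia.
  have [||e e1 E] := @symsum_range R theta M N I t M0 IN.
  - by clear -IR N1R; lra.
  - by clear -IR N1R N2R; lra.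
  exists e => //; apply: le_trans (ler_wpM2l _ e1); last by [].
  have -> : M `^ (theta - 1) = M * M `^ (theta - 2).
    by rewrite -[X in X * _]powRr1 -?powRD ?(gt_eqF M0) ?implybT ?ltW//; congr (_ `^ _); ring.
  have -> : `|theta - 1| * (theta * M `^ (theta - 2) / 64 * (I%:R * (I%:R - 1))) =
     theta * M `^ (theta - 2) * (`|theta - 1| * I%:R * (I%:R - 1) / 64) by ring.
  have -> : 16 * theta * (M * M `^ (theta - 2)) = theta * M `^ (theta - 2) * (16 * M) by ring.
  apply: ler_wpM2l; first by rewrite mulr_ge0 ?ltW//; lra.
  have J1 : 1 <= j%:R :> R by rewrite ler1n.
  have IE : I%:R = 64 * j%:R * m%:R :> R by rewrite ID !natrM.
  have h1 : 64 * m%:R <= `|theta - 1| * I%:R by rewrite IE; nra.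
  have h2 : 16 * m%:R <= I%:R - 1 :> R by rewrite IE; nra.
  have : (64 * m%:R) * (16 * m%:R) <= `|theta - 1| * I%:R * (I%:R - 1).
    by apply: ler_pM => //; lra.
  by rewrite MD expr2; lra.
have s0 N : symsum theta N 0 = 2 * N%:R `^ theta by rewrite /symsum addn0 subn0; ring.
have [||N /andP[N1 N2] N3] := @bracket R (symsum theta ^~ 0%N) y (m ^ 2) (3 * m ^ 2).
- by rewrite muln_gt0 expn_gt0 m0.
- rewrite !s0 -ME -mulSn.
  by rewrite natrM -ME.
have N1R : M <= N%:R by rewrite ME ler_nat.
have N2R : N%:R + 1 <= 4 * M by rewrite ME -natrM natr1 ler_nat; clear -N2; lia.
have gap : symsum theta N.+1 0 - symsum theta N 0 <= 16 * theta * M `^ (theta - 1).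
  have := @powR_gap R theta M N%:R t M0 N1R ltac:(lra).
  by rewrite !s0 -[N.+1%:R]natr1 => h; clear -h; lra.
have [h|h] := leP 0 (theta - 1).
- have [|e e1 E] := reach N; first by clear -N1 N2; lia.
  rewrite ger0_norm// in e1.
  have [||i iI H] := walk N y; [clear -N1 N2; lia|left; clear -N3 E e1 gap; lra|].
  by exists N, i; split => //; clear -iI I2 N1 N2 m0; nia.
- have [|e e1 E] := reach N.+1; first by clear -N1 N2; lia.
  rewrite ltr0_norm// in e1.
  have [||i iI H] := walk N.+1 y; [clear -N1 N2; lia|right; clear -N3 E e1 gap; lra|].
  by exists N.+1, i; split => //; clear -iI I2 N1 N2 m0; nia.
Qed.

(** * The bound for all n, with a constant depending on an integer j *)

Lemma min_dist_le (R : realType) (theta alpha : R) (n u v : nat) (z : int) :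
  (1 <= u <= n)%N -> (1 <= v <= n)%N ->
  min_dist theta alpha n <= `|u%:R `^ theta + v%:R `^ theta - (alpha + z%:~R)|.
Proof.
move=> un vn; have lb x : lbound [set `|x - m%:~R| | m in [set: int]] (0 : R).
  by move=> _ [m _ <-].
apply: (@le_trans _ _ (dist_int (u%:R `^ theta + v%:R `^ theta - alpha))).
  apply: ge_inf; last by exists (u, v).
  exists 0 => _ [p _ <-]; apply: lb_le_inf => //.
  by exists `|p.1%:R `^ theta + p.2%:R `^ theta - alpha - 0%:~R|, 0.
rewrite opprD addrA; apply: ge_inf; last by exists z.
by exists 0.
Qed.

Lemma int_near (R : realType) (x : R) : exists z : int, x <= z%:~R <= x + 1.
Proof.
have /andP[h1 h2] := floor_itv x.
by exists (Num.floor x + 1)%R; move: h2; rewrite intrD => h2; apply/andP; lra.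
Qed.

Lemma min_dist_le1 (R : realType) (theta alpha : R) (n : nat) :
  (1 <= n)%N -> min_dist theta alpha n <= 1.
Proof.
move=> n1; have [z /andP[z1 z2]] := int_near (1%:R `^ theta + 1%:R `^ theta - alpha).
apply: le_trans (@min_dist_le R theta alpha n 1 1 z _ _) _; rewrite ?n1//.
by rewrite ler_norml; lra.
Qed.

Lemma oct_sqrt (n : nat) : exists m, (8 * m ^ 2 <= n < 8 * m.+1 ^ 2)%N.
Proof.
have exP : exists m, (8 * m ^ 2 <= n)%N by exists 0%N.
have bound m : (8 * m ^ 2 <= n)%N -> (m <= n)%N by nia.
case: (ex_maxnP exP bound) => m mn mmax; exists m; rewrite mn ltnNge /=.
by apply/negP => /mmax; rewrite ltnn.
Qed.

(** The trivial bound 1 is enough: n^(3/2 - theta) <= n^2 is absorbed by the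
    constant. *)
Lemma min_dist_small (R : realType) (theta alpha : R) (n j : nat) :
  0 < theta < 3 / 2 -> (1 <= j)%N -> (1 <= n)%N ->
  (n <= 8 * (2 ^ (8 * j ^ 2)) ^ 2)%N ->
  min_dist theta alpha n <= 2 ^+ (40 * j ^ 2) * n%:R `^ (theta - 3 / 2).
Proof.
move=> /andP[t0 t1] j1 n1 nj.
apply: le_trans (min_dist_le1 theta alpha n1) _.
have -> : theta - 3 / 2 = - (3 / 2 - theta) by ring.
have nR : 1 <= n%:R :> R by rewrite ler1n.
have P0 : 0 < (n%:R : R) `^ (3 / 2 - theta) by apply: powR_gt0; lra.
rewrite powRN ler_pdivlMr// mul1r.
apply: (@le_trans _ _ ((n%:R : R) ^+ 2)); first by apply: powR_le_nat => //; lra.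
rewrite -!natrX ler_nat; apply: (@leq_trans ((2 ^ (3 + 16 * j ^ 2)) ^ 2)%N).
  by rewrite leq_exp2r//; apply: (leq_trans nj); rewrite -expnM expnD leq_mul// leq_exp2l//; lia.
by rewrite -expnM leq_exp2l//; nia.
Qed.

(** Here M = m^2 is of the order of n, with 8 M <= n < 32 M so that all the
    arguments N + i and N - i stay in range.  The lower bound on m ensures
    M^theta >= 2^(j^2 theta) >= 2^j >= j >= 1 / theta. *)
Lemma min_dist_large (R : realType) (theta alpha : R) (n j m : nat) :
  0 < theta < 3 / 2 -> 1 <= j%:R * theta -> 1 <= j%:R * `|theta - 1| ->
  (2 ^ (8 * j ^ 2) <= m)%N -> (8 * m ^ 2 <= n < 8 * m.+1 ^ 2)%N ->
  min_dist theta alpha n <= 2 ^+ (40 * j ^ 2) * n%:R `^ (theta - 3 / 2).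
Proof.
move=> t jt jt1 jm /andP[n1 n2]; have /andP[t0 t1] := t.
have j1 : (1 <= j)%N by case: j jt {jt1 jm} => //; rewrite mul0r ler10.
have jj : (j <= j ^ 2)%N by nia.
have j2 : (j < 2 ^ j)%N by exact: ltn_expl.
have m128 : (128 * j <= m)%N.
  apply: leq_trans jm; apply: (@leq_trans (2 ^ (7 + j))); last by rewrite leq_exp2l//; nia.
  by rewrite expnD leq_mul// ltnW.
have m1 : (1 <= m)%N by clear -m128 j1; lia.
have [M MD] : exists M : R, M = m%:R ^+ 2 by exists (m%:R ^+ 2).
have mR : 1 <= m%:R :> R by rewrite ler1n.
have mM : m%:R <= M by rewrite MD; clear -mR; nra.
have M0 : 0 < M by clear -mR mM; lra.
have big : 1 <= theta * M `^ theta.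
  apply: (le_trans jt); rewrite mulrC ler_pM2l//.
  apply: (@le_trans _ _ ((2 ^+ (j ^ 2)) `^ theta)).
    apply: (@le_trans _ _ (2 ^+ j)); first by rewrite -natrX ler_nat ltnW.
    rewrite -[2 ^+ (j ^ 2)]powR_mulrn// -powRrM -powR_mulrn// ler_powR//; first lra.
    have := ler_wpM2l (ler0n R j) jt; rewrite mulr1 mulrA natrX expr2; exact.
  apply: ge0_ler_powR; [lra|by rewrite nnegrE exprn_ge0|by rewrite nnegrE; lra|].
  apply: le_trans mM; rewrite -natrX ler_nat; apply: leq_trans jm.
  by rewrite leq_exp2l//; lia.
have growth := powR_growth t M0 big.
have [z /andP[z1 z2]] := int_near (2 * M `^ theta - alpha).
have [|N [i [iN Ni H]]] := @symsum_dense R theta (alpha + z%:~R) j m t jt1 m128 M MD.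
  by clear -z1 z2 growth; lra.
apply: le_trans (@min_dist_le R theta alpha n (N + i) (N - i) z _ _) _.
- by clear -iN Ni n1; lia.
- by clear -iN Ni n1; lia.
apply: (le_trans H).
have n0 : (0 < n)%N by clear -n1 m1; nia.
have -> : 96 * (64 * j * m)%:R * M `^ (theta - 2) =
    96 * 64 * j%:R * M `^ (theta - 3 / 2) :> R.
  have -> : theta - 3 / 2 = 2^-1 + (theta - 2) by lra.
  rewrite (@powRD _ M 2^-1) ?(gt_eqF M0) ?implybT// powR12_sqrt ?(ltW M0)//.
  by rewrite {2}MD sqrtr_sqr ger0_norm// !natrM; ring.
(* m M^(theta-2) = M^(theta-3/2), and M and n agree up to a factor 32 *)
have K : M `^ (theta - 3 / 2) <= (2 ^+ 5) ^+ 2 * n%:R `^ (theta - 3 / 2).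
  have up : (m ^ 2 <= 2 ^ 5 * n)%N by clear -n1; have := expn_gt0 2 5; nia.
  have lo : (n <= 2 ^ 5 * m ^ 2)%N.
    by clear -n2 m1; rewrite [(2 ^ 5)%N]/(4 * 8)%N; nia.
  apply: powR_comparable => //; rewrite ?ltr0n//.
  - by rewrite MD -!natrX -natrM ler_nat.
  - by rewrite MD -!natrX -natrM ler_nat.
  - by rewrite ler_norml; apply/andP; split; lra.
apply: (@le_trans _ _ (2 ^+ 7 * 2 ^+ 6 * 2 ^+ j * ((2 ^+ 5) ^+ 2 * n%:R `^ (theta - 3 / 2)))).
  have c96 : 96 <= 2 ^+ 7 :> R by rewrite -natrX ler_nat.
  have c64 : 64 <= 2 ^+ 6 :> R by rewrite -natrX ler_nat.
  have cj : j%:R <= 2 ^+ j :> R by rewrite -natrX ler_nat ltnW.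
  by apply: ler_pM => //; rewrite ?mulr_ge0 ?powR_ge0//; do !(apply: ler_pM; rewrite ?mulr_ge0//).
rewrite mulrA; apply: ler_wpM2r; first exact: powR_ge0.
by rewrite -exprM -!exprD -!natrX ler_nat leq_exp2l//; clear -j1 jj; lia.
Qed.

Lemma min_dist_bound (R : realType) (theta alpha : R) (n j : nat) :
  0 < theta < 3 / 2 -> 1 <= j%:R * theta -> 1 <= j%:R * `|theta - 1| ->
  (1 <= n)%N ->
  min_dist theta alpha n <= 2 ^+ (40 * j ^ 2) * n%:R `^ (theta - 3 / 2).
Proof.
move=> t jt jt1 n1; have [m mn] := oct_sqrt n.
have [jm|jm] := leqP (2 ^ (8 * j ^ 2)) m; first exact: (min_dist_large _ t jt jt1 jm mn).
apply: min_dist_small => //; first by case: j jt {jt1 jm} => //; rewrite mul0r ler10.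
by case/andP: mn => _ /ltnW h; apply: (leq_trans h); rewrite leq_mul2l leq_exp2r// jm.
Qed.

(** * Programs for arithmetic *)

Local Notation eval := Defs.eval.

Definition constR (n : nat) : recfun := iter n (fun f => RComp RSucc [:: f]) RZero.

Lemma eval_comp1 phi f g xs x y :
  eval phi g xs x -> eval phi f [:: x] y -> eval phi (RComp f [:: g]) xs y.
Proof. by move=> h; apply: EvalComp; do !constructor. Qed.

Lemma eval_comp2 phi f g h xs x y z :
  eval phi g xs x -> eval phi h xs y -> eval phi f [:: x; y] z ->
  eval phi (RComp f [:: g; h]) xs z.
Proof. by move=> ? ?; apply: EvalComp; do !constructor. Qed.

Lemma eval_comp3 phi f g1 g2 g3 xs x1 x2 x3 z :
  eval phi g1 xs x1 -> eval phi g2 xs x2 -> eval phi g3 xs x3 ->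
  eval phi f [:: x1; x2; x3] z -> eval phi (RComp f [:: g1; g2; g3]) xs z.
Proof. by move=> ? ? ?; apply: EvalComp; do !constructor. Qed.

Lemma eval_const phi n xs : eval phi (constR n) xs n.
Proof.
elim: n => [|n IH]; first exact: EvalZero.
exact: (eval_comp1 IH (EvalSucc _ _)).
Qed.

Lemma eval_rec phi f g (F : nat -> nat) xs n :
  eval phi f xs (F 0%N) ->
  (forall k, (k < n)%N -> eval phi g [:: k, F k & xs] (F k.+1)) ->
  eval phi (RPrec f g) (n :: xs) (F n).
Proof.
move=> f0; elim: n => [|n IH] gS; first exact: EvalPrec0.
by apply: EvalPrecS (gS n (ltnSn n)); apply: IH => k kn; apply: gS; apply: leqW.
Qed.

Definition addR f g := RComp (RPrec (RProj 0) (RComp RSucc [:: RProj 1])) [:: f; g].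
Definition mulR f g := RComp (RPrec RZero (addR (RProj 2) (RProj 1))) [:: f; g].
Definition predR f := RComp (RPrec RZero (RProj 0)) [:: f].
(** Truncated subtraction recurses on the subtrahend, hence the exchanged
    arguments. *)
Definition subR f g := RComp (RPrec (RProj 0) (predR (RProj 1))) [:: g; f].
Definition pow2R f :=
  RComp (RPrec (constR 1) (mulR (constR 2) (RProj 1))) [:: f].
Definition oracleR f := RComp ROracle [:: f].

Lemma eval_add phi f g xs x y :
  eval phi f xs x -> eval phi g xs y -> eval phi (addR f g) xs (x + y)%N.
Proof.
move=> hf hg; apply: (eval_comp2 hf hg).
apply: (@eval_rec _ _ _ (fun k => k + y)%N) => [|k _]; first exact: EvalProj.
exact: eval_comp1 (EvalProj _ _ _) (EvalSucc _ _).
Qed.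

Lemma eval_mul phi f g xs x y :
  eval phi f xs x -> eval phi g xs y -> eval phi (mulR f g) xs (x * y)%N.
Proof.
move=> hf hg; apply: (eval_comp2 hf hg).
apply: (@eval_rec _ _ _ (fun k => k * y)%N) => [|k _]; first exact: EvalZero.
rewrite mulSn; exact: eval_add (EvalProj _ 2 _) (EvalProj _ 1 _).
Qed.

Lemma eval_pred phi f xs x : eval phi f xs x -> eval phi (predR f) xs x.-1.
Proof.
move=> hf; apply: (eval_comp1 hf).
apply: (@eval_rec _ _ _ predn) => [|k _]; first exact: EvalZero.
exact: (EvalProj _ 0).
Qed.

Lemma eval_sub phi f g xs x y :
  eval phi f xs x -> eval phi g xs y -> eval phi (subR f g) xs (x - y)%N.
Proof.
move=> hf hg; apply: (eval_comp2 hg hf).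
apply: (@eval_rec _ _ _ (fun k => x - k)%N) => [|k _].
  by rewrite subn0; exact: (EvalProj _ 0).
by rewrite subnS; apply: eval_pred; exact: (EvalProj _ 1).
Qed.

Lemma eval_pow2 phi f xs x : eval phi f xs x -> eval phi (pow2R f) xs (2 ^ x)%N.
Proof.
move=> hf; apply: (eval_comp1 hf).
apply: (@eval_rec _ _ _ (expn 2)) => [|k _]; first exact: eval_const.
by rewrite expnS; apply: eval_mul (eval_const _ _ _) (EvalProj _ 1 _).
Qed.

Lemma eval_oracle phi f xs x : eval phi f xs x -> eval phi (oracleR f) xs (phi x).
Proof. by move=> hf; apply: (eval_comp1 hf); exact: (EvalOracle _ [:: x]). Qed.

(** The summand sees its index, the partial sum and the remaining arguments, in
    this order. *)
Lemma eval_sum phi f (F : nat -> nat) xs n :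
  (forall k y, eval phi f [:: k, y & xs] (F k)) ->
  eval phi (RPrec RZero (addR (RProj 1) f)) (n :: xs) (\sum_(k < n) F k)%N.
Proof.
move=> hf; apply: (@eval_rec _ _ _ (fun n => \sum_(k < n) F k)%N) => [|k _].
  by rewrite big_ord0; exact: EvalZero.
by rewrite big_ord_recr /=; apply: eval_add; [exact: (EvalProj _ 1)|exact: hf].
Qed.

Lemma eval_mu phi f (F : nat -> nat) xs (exF : exists k, F k == 0%N) :
  (forall k, eval phi f (k :: xs) (F k)) -> eval phi (RMu f) xs (ex_minn exF).
Proof.
move=> hf; case: ex_minnP => k /eqP Fk mink; apply: EvalMu; first by rewrite -Fk.
move=> j jk; exists (F j).-1; rewrite prednK ?hf// lt0n.
by apply: contraL jk => /mink; rewrite -leqNgt.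
Qed.

(** * A continuous constant and its approximation in integers *)

Definition gap (R : realType) (theta : R) : R := Num.min theta `|theta - 1|.

Definition weight (j : nat) : nat := (2 ^ (40 * (j * j)))%N.

(** Each summand is a ramp in d that vanishes for j d >= 3.  So the value does not
    depend on L once L d >= 3, which makes it a continuous function of d > 0 even
    though L has to grow as d tends to 0. *)
Definition ramps (R : realType) (d : R) (L : nat) : R :=
  \sum_(j < L) (weight j)%:R * Num.max 0 (3 - j%:R * d).

Definition eff_const (R : realType) (theta : R) : R :=
  ramps (gap theta) (Num.bound (3 / gap theta)).

Lemma gap_gt0 (R : realType) (theta : R) :
  0 < theta < 1 \/ 1 < theta < 3 / 2 -> 0 < gap theta <= 1.
Proof.
move=> t; rewrite /gap lt_min ge_min normr_gt0 subr_eq0.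
apply/andP; split; first by apply/andP; split; [lra|case: eqVneq => // h; lra].
by apply/orP; case: t => /andP[? ?]; [left; lra|right; rewrite ger0_norm; lra].
Qed.

Lemma ramps_stable (R : realType) (d : R) (L L' : nat) :
  0 < d -> 3 <= L%:R * d -> 3 <= L'%:R * d -> ramps d L = ramps d L'.
Proof.
move=> d0; wlog LL : L L' / (L <= L')%N => [H h h'|h _].
  by have [/H->|/ltnW/H->] := leqP L L'.
rewrite /ramps -!(big_mkord xpredT (fun j => (weight j)%:R * Num.max 0 (3 - j%:R * d))).
rewrite [RHS](big_cat_nat _ LL)//= [X in _ = _ + X]big_nat_cond.
rewrite [X in _ = _ + X]big1 ?addr0// => j /andP[/andP[Lj _] _].
rewrite max_l ?mulr0// subr_le0; apply: (le_trans h).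
by rewrite ler_pM2r// ler_nat.
Qed.

Lemma bound_gap (R : realType) (d : R) : 0 < d -> 3 <= (Num.bound (3 / d))%:R * d.
Proof.
by move=> d0; rewrite -ler_pdivrMr// ltW// archi_boundP// divr_ge0// ltW.
Qed.

Lemma eff_constE (R : realType) (theta : R) (L : nat) :
  0 < gap theta -> 3 <= L%:R * gap theta -> eff_const theta = ramps (gap theta) L.
Proof. by move=> d0 Ld; apply: ramps_stable => //; exact: bound_gap. Qed.

(** The j-th term alone is at least the j-th weight, since 3 - j d >= 1. *)
Lemma weight_le_eff_const (R : realType) (theta : R) (j : nat) :
  0 < gap theta -> j%:R * gap theta <= 2 -> (weight j)%:R <= eff_const theta.
Proof.
move=> d0 jd; rewrite /eff_const; have := bound_gap d0.
move: (Num.bound _) => L Ld.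
have jL : (j < L)%N.
  rewrite ltnNge; apply/negP => Lj.
  have : L%:R * gap theta <= j%:R * gap theta by rewrite ler_pM2r// ler_nat.
  by lra.
have pos (i : 'I_L) : 0 <= (weight i)%:R * Num.max 0 (3 - i%:R * gap theta).
  by rewrite mulr_ge0// le_max lexx.
rewrite /ramps (bigD1 (Ordinal jL))//= -[leLHS]addr0.
apply: lerD; last by apply: sumr_ge0.
by rewrite ler_peMr// le_max; apply/orP; right; lra.
Qed.

Lemma natr_subn (R : realType) (a b : nat) :
  (a - b)%:R = Num.max 0 (a%:R - b%:R) :> R.
Proof.
have [ab|/ltnW ab] := leqP a b.
  by rewrite max_l ?subr_le0 ?ler_nat//; move/eqP: ab => ->.
by rewrite max_r ?subr_ge0 ?ler_nat// natrB.
Qed.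

(** The gap of the dyadic approximation phi t / 2^t, scaled by 2^t: the two
    truncated differences add up to a distance, and a - (a - b) is the minimum of
    a and b. *)
Definition gapN (phi : nat -> nat) (t : nat) : nat :=
  (phi t - (phi t - ((phi t - 2 ^ t) + (2 ^ t - phi t))))%N.

Lemma gapNE (R : realType) (phi : nat -> nat) (t : nat) :
  (gapN phi t)%:R = Num.min (phi t)%:R `|(phi t)%:R - 2 ^+ t| :> R.
Proof.
have -> : `|(phi t)%:R - 2 ^+ t| = ((phi t - 2 ^ t) + (2 ^ t - phi t))%:R :> R.
  rewrite -natrX; have [h|/ltnW h] := leqP (phi t) (2 ^ t).
    by rewrite (eqP h) ler0_norm ?subr_le0 ?ler_nat// opprB natrB.
  by rewrite (eqP h) addn0 ger0_norm ?subr_ge0 ?ler_nat// natrB.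
rewrite /gapN -minnE; move: (_ + _)%N => b.
have [h|/ltnW h] := leqP (phi t) b; first by rewrite min_l// ler_nat.
by rewrite min_r// ler_nat.
Qed.

(** The gap is 1-Lipschitz in theta. *)
Lemma gapN_approx (R : realType) (phi : nat -> nat) (theta : R) (t : nat) :
  is_name phi theta -> `|2 ^+ t * gap theta - (gapN phi t)%:R| <= 1.
Proof.
move=> /(_ t); rewrite gapNE.
have T0 : 0 < 2 ^+ t :> R by rewrite exprn_gt0.
have -> : theta - (phi t)%:R / 2 ^+ t = (2 ^+ t * theta - (phi t)%:R) / 2 ^+ t.
  by rewrite mulrBl mulrAC divff ?mul1r// gt_eqF.
rewrite normrM [`|_^-1|]gtr0_norm ?invr_gt0// ler_pdivrMr// mulVf ?gt_eqF//.
move: ((phi t)%:R) => a; rewrite /gap; move: T0; move: (2 ^+ t) => T T0 h.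
have -> : T * Num.min theta `|theta - 1| = Num.min (T * theta) `|T * theta - T|.
  by rewrite minr_pMr ?ltW// -[X in X * `|_|](gtr0_norm T0) -normrM mulrBr mulr1.
have := ler_dist_dist (T * theta - T) (a - T).
have -> : T * theta - T - (a - T) = T * theta - a by ring.
move=> /le_trans/(_ h); move: h; rewrite !ler_norml.
move: (T * theta) `|_ - T| `|a - T| => x u v /andP[h1 h2] /andP[h3 h4].
by have [?|?] := leP x u; have [?|?] := leP a v; apply/andP; split; lra.
Qed.

Lemma ramp_approx (R : realType) (d : R) (p j D : nat) :
  `|2 ^+ p * d - D%:R| <= 1 ->
  `|2 ^+ p * Num.max 0 (3 - j%:R * d) - (3 * 2 ^ p - j * D)%:R| <= j%:R.
Proof.
move=> h; have P0 : 0 < 2 ^+ p :> R by rewrite exprn_gt0.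
rewrite natr_subn !natrM natrX maxr_pMr ?(ltW P0)// mulr0.
have : `|j%:R * (2 ^+ p * d) - j%:R * D%:R| <= j%:R.
  by rewrite -mulrBr normrM ger0_norm// ler_piMr.
have -> : 2 ^+ p * (3 - j%:R * d) = 3 * 2 ^+ p - j%:R * (2 ^+ p * d) by ring.
move: (3 * _) (j%:R * (_ * _)) (j%:R * D%:R) => u v w.
rewrite !ler_norml => /andP[h1 h2]; rewrite /Num.max /Order.max.
by repeat (case: ifPn; rewrite -?leNgt => ?); apply/andP; split; lra.
Qed.

Definition rampsN (D p L : nat) : nat :=
  (\sum_(j < L) weight j * (3 * 2 ^ p - j * D))%N.

(** The integer sum [rampsN] inherits an error of at most j from the j-th ramp,
    multiplied by the j-th weight. *)
Definition errN (L : nat) : nat := (\sum_(j < L) weight j * j)%N.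

Lemma rampsN_approx (R : realType) (d : R) (p D L : nat) :
  `|2 ^+ p * d - D%:R| <= 1 ->
  `|2 ^+ p * ramps d L - (rampsN D p L)%:R| <= (errN L)%:R.
Proof.
move=> h; rewrite /ramps /rampsN /errN !natr_sum mulr_sumr -sumrB.
apply: (le_trans (ler_norm_sum _ _ _)); apply: ler_sum => j _.
rewrite !natrM mulrCA -mulrBr normrM ger0_norm//.
by apply: ler_wpM2l => //; exact: ramp_approx.
Qed.

(** Rounding S to a multiple of 2^(q+1) costs at most 2^q, and the approximation
    error q is at most 2^q as well; relative to the scale 2^(k+q+1) each of the
    two is at most half a unit 2^-k. *)
Lemma round_name (R : realType) (x : R) (k q S y : nat) :
  `|2 ^+ (k + q + 1) * x - S%:R| <= q%:R ->
  (S <= y * 2 ^ (q + 1) + 2 ^ q)%N -> (y * 2 ^ (q + 1) <= S + 2 ^ q)%N ->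
  `|x - y%:R / 2 ^+ k| <= 2 ^- k.
Proof.
move=> Sx; rewrite -!(ler_nat R) !natrD !natrM !natrX => h1 h2.
have K0 : 0 < 2 ^+ k :> R by rewrite exprn_gt0.
have Q0 : 0 < 2 ^+ q :> R by rewrite exprn_gt0.
have qQ : q%:R <= 2 ^+ q :> R by rewrite -natrX ler_nat ltnW// ltn_expl.
rewrite !exprD !expr1 in Sx h1 h2.
have -> : x - y%:R / 2 ^+ k = (2 ^+ k * x - y%:R) / 2 ^+ k.
  by rewrite mulrBl mulrAC divff ?mul1r// gt_eqF.
rewrite normrM [`|_^-1|]gtr0_norm ?invr_gt0// -[leRHS]mul1r ler_pM2r ?invr_gt0//.
rewrite -(ler_pM2l Q0) -[X in X * `|_|](gtr0_norm Q0) -normrM mulr1.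
by move: Sx; rewrite !ler_norml => /andP[s1 s2]; apply/andP; split; lra.
Qed.

(** * The program computing the constant *)

Definition gapR t :=
  let a := oracleR t in let b := pow2R t in
  subR a (subR a (addR (subR a b) (subR b a))).

Definition weightR j := pow2R (mulR (constR 40) (mulR j j)).

(** The search stops at a precision t where the approximate gap, scaled by 2^t, is at
    least 2, so that the true gap is at least 2^-t and 3 * 2^t is a valid summation range. *)
Definition lenR :=
  mulR (constR 3) (pow2R (RMu (subR (constR 2) (gapR (RProj 0))))).

Definition errR :=
  RComp (RPrec RZero (addR (RProj 1) (mulR (weightR (RProj 0)) (RProj 0)))) [:: lenR].

(** In the summand, argument 0 is the index, 2 is the precision and 3 the
    approximate gap. *)
Definition rampsR D p :=
  RComp (RPrec RZero (addR (RProj 1) (mulR (weightR (RProj 0))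
    (subR (mulR (constR 3) (pow2R (RProj 2))) (mulR (RProj 0) (RProj 3))))))
    [:: lenR; p; D].

(** The input k is argument 1, below the candidate output y of the search.  The
    precision p exceeds k by one more than the error bound, and the search returns
    the least y for which (y + 1/2) 2^(err+1) reaches the integer sum, that is the
    sum divided by 2^(err+1) and rounded to a nearest integer. *)
Definition constantR :=
  let p := addR (addR (RProj 1) errR) (constR 1) in
  RMu (subR (rampsR (gapR p) p)
    (addR (mulR (RProj 0) (pow2R (addR errR (constR 1)))) (pow2R errR))).

Lemma eval_gap phi f xs t :
  eval phi f xs t -> eval phi (gapR f) xs (gapN phi t).
Proof.
by move=> h; repeat first [apply: eval_sub|apply: eval_add|apply: eval_pow2|apply: eval_oracle].
Qed.

Lemma eval_weight phi f xs j :
  eval phi f xs j -> eval phi (weightR f) xs (weight j).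
Proof.
by move=> h; apply/eval_pow2/eval_mul; [exact: eval_const|exact: eval_mul].
Qed.

Lemma eval_len (R : realType) (theta : R) phi :
  is_name phi theta -> 0 < gap theta ->
  exists2 L, 3 <= L%:R * gap theta & forall xs, eval phi lenR xs L.
Proof.
move=> name d0.
have exF : exists t, (2 - gapN phi t)%N == 0%N.
  pose t := Num.bound (3 / gap theta); exists t.
  rewrite subn_eq0 -(ler_nat R).
  have : 3 <= 2 ^+ t * gap theta.
    apply: (le_trans (bound_gap d0)); rewrite ler_pM2r// -natrX ler_nat ltnW//.
    exact: ltn_expl.
  by have := gapN_approx t name; rewrite ler_norml => /andP[? ?] ?; lra.
exists (3 * 2 ^ ex_minn exF)%N => [|xs]; last first.
  apply: eval_mul; first exact: eval_const.
  apply/eval_pow2/eval_mu => t; apply: eval_sub; first exact: eval_const.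
  by apply: eval_gap; exact: (EvalProj _ 0).
case: ex_minnP => t; rewrite subn_eq0 -(ler_nat R) => h _.
have := gapN_approx t name; rewrite natrM natrX ler_norml => /andP[? ?].
by rewrite -mulrA; lra.
Qed.

Lemma eval_err phi xs L : eval phi lenR xs L -> eval phi errR xs (errN L).
Proof.
move=> h; apply: (eval_comp1 h).
apply: (@eval_sum _ _ (fun j => weight j * j)%N) => j y.
by apply: eval_mul; [apply: eval_weight|]; exact: (EvalProj _ 0).
Qed.

Lemma eval_ramps phi D p xs d q L :
  eval phi lenR xs L -> eval phi D xs d -> eval phi p xs q ->
  eval phi (rampsR D p) xs (rampsN d q L).
Proof.
move=> hL hD hp; apply: (eval_comp3 hL hp hD).
apply: (@eval_sum _ _ (fun j => weight j * (3 * 2 ^ q - j * d))%N) => j y.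
apply: eval_mul; first by apply: eval_weight; exact: (EvalProj _ 0).
apply: eval_sub; last by apply: eval_mul; [exact: (EvalProj _ 0)|exact: (EvalProj _ 3)].
by apply: eval_mul; [exact: eval_const|apply/eval_pow2/(EvalProj _ 2)].
Qed.

Lemma eff_const_computable (R : realType) :
  computable_on [set theta : R | 0 < theta < 1 \/ 1 < theta < 3 / 2] (@eff_const R).
Proof.
exists constantR => theta /= /gap_gt0 /andP[d0 _] phi name.
have [L L3 hL] := eval_len name d0.
pose q := errN L; pose p k := (k + q + 1)%N.
pose S k := rampsN (gapN phi (p k)) (p k) L.
pose F k y := (S k - (y * 2 ^ (q + 1) + 2 ^ q))%N.
have exF k : exists y, F k y == 0%N.
  exists (S k); rewrite /F subn_eq0.
  by apply: (leq_trans _ (leq_addr _ _)); rewrite leq_pmulr// expn_gt0.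
exists (fun k => ex_minn (exF k)) => k.
  have app := rampsN_approx L (gapN_approx (p k) name).
  rewrite (eff_constE d0 L3).
  case: ex_minnP => y; rewrite subn_eq0 => Sy miny.
  apply: (@round_name R _ k q (S k)) => //.
  (* for y > 0, minimality of y means that (y - 1/2) 2^(q+1) < S k *)
  case: y Sy miny => [//|y] _ miny.
  have : (F k y != 0)%N by apply/negP => /miny; rewrite ltnn.
  rewrite subn_eq0 -ltnNge addn1 expnS; lia.
have hk xs y : eval phi (RProj 1) [:: y, k & xs] k by exact: (EvalProj _ 1).
apply: (eval_mu (F := F k)) => y.
have herr : eval phi errR [:: y; k] q by exact: eval_err.
have hp : eval phi (addR (addR (RProj 1) errR) (constR 1)) [:: y; k] (p k).
  by apply: eval_add; [apply: eval_add|exact: eval_const].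
apply: eval_sub; first by apply: eval_ramps => //; exact: eval_gap.
apply: eval_add; last exact: eval_pow2.
apply: eval_mul; first exact: (EvalProj _ 0).
by apply/eval_pow2/eval_add => //; exact: eval_const.
Qed.

(** * The theorem *)

Theorem corollary1p3 (R : realType) :
  exists C : R -> R,
    computable_on [set theta : R | 0 < theta < 1 \/ 1 < theta < 3 / 2] C /\
    forall theta : R, (0 < theta < 1 \/ 1 < theta < 3 / 2) ->
      0 < C theta /\
      forall (alpha : R) (n : nat), (1 <= n)%N ->
        min_dist theta alpha n <= C theta * n%:R `^ (theta - 3 / 2).
Proof.
exists (@eff_const R); split; first exact: eff_const_computable.
move=> theta t; have /andP[d0 d1] := gap_gt0 t.
(* j = floor (1 / d) + 1, and d <= 1 *)
have [j /andP[j1 j2]] : exists j : nat, 1 <= j%:R * gap theta <= 2.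
  have /andP[h1 h2] := truncn_itv (ltW (divr_gt0 ltr01 d0)).
  exists (Num.trunc (1 / gap theta)).+1.
  rewrite ltr_pdivrMr// in h2; rewrite ler_pdivlMr// in h1.
  by rewrite (ltW h2) -natr1 mulrDl; lra.
have wC := weight_le_eff_const d0 j2.
split.
  by apply: (lt_le_trans _ wC); rewrite ltr0n expn_gt0.
move=> alpha n n1.
have le1 (x : R) : gap theta <= x -> 1 <= j%:R * x.
  by move=> dx; apply: (le_trans j1); apply: ler_wpM2l.
apply: (le_trans (@min_dist_bound R theta alpha n j _ _ _ n1)).
- by lra.
- by apply: le1; rewrite ge_min lexx.
- by apply: le1; rewrite ge_min lexx orbT.
by apply: ler_wpM2r; [exact: powR_ge0|rewrite -mulnn -natrX].
Qed.
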